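(* If a nonzero real Banach space $X$ has the Daugavet property, then $X$ contains a copy of $\ell_1$, i.e., a closed subspace isomorphic to $\ell_1$.
   Context: A Banach space $X$ has the Daugavet property if $\|\mathrm{Id}+T\|=1+\|T\|$ for every bounded linear operator $T\colon X\to X$ of rank $1$. *)

(* Defs.v *)
From HB Require Import structures.
From mathcomp Require Import all_boot all_order all_algebra.
From mathcomp Require Import all_classical all_reals all_analysis.

Set Implicit Arguments.
Unset Strict Implicit.
Unset Printing Implicit Defensive.

Import Order.TTheory GRing.Theory Num.Theory.
Import numFieldNormedType.Exports.

Local Open Scope classical_set_scope.
Local Open Scope ring_scope.

Section Ell1.
Context {R : realType}.
Implicit Types u v : R^nat.

Definition abs_series u : R^nat := [series `|u k|]_k.

Definition abs_summable : {pred R^nat} := [pred u | `[< cvgn (abs_series u) >]].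

Definition l1norm u : R := limn (abs_series u).

Lemma abs_summableP u : reflect (cvgn (abs_series u)) (u \in abs_summable).
Proof. exact: asboolP. Qed.

Lemma abs_seriesZ (a : R) u :
  abs_series (a *: u) = `|a| *: abs_series u.
Proof.
apply/funext => n.
have -> : (`|a| *: abs_series u) n = `|a| * abs_series u n by [].
by rewrite /abs_series /series /= mulr_sumr; apply: eq_bigr => i _; exact: normrM.
Qed.

Lemma abs_series_nd u : nondecreasing_seq (abs_series u).
Proof. by apply: nondecreasing_series => n _ _; exact: normr_ge0. Qed.

Lemma abs_seriesD_le u v n :
  abs_series (u + v) n <= abs_series u n + abs_series v n.
Proof.
rewrite /abs_series /series /= -big_split /=.
by apply: ler_sum => i _; exact: ler_normD.
Qed.

Lemma abs_summableD u v :
  u \in abs_summable -> v \in abs_summable -> u + v \in abs_summable.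
Proof.
move=> /abs_summableP cu /abs_summableP cv; apply/abs_summableP.
apply: nondecreasing_is_cvgn; first exact: abs_series_nd.
exists (l1norm u + l1norm v) => _ [n _ <-].
apply: le_trans (abs_seriesD_le u v n) _; apply: lerD;
  apply: nondecreasing_cvgn_le => //; exact: abs_series_nd.
Qed.

Lemma abs_summableZ (a : R) u :
  u \in abs_summable -> a *: u \in abs_summable.
Proof.
move=> /abs_summableP cu; apply/abs_summableP.
by rewrite abs_seriesZ; exact: is_cvgZr.
Qed.

Lemma abs_summable_submod_closed : submod_closed abs_summable.
Proof.
split=> [|a u v uS vS]; last first.
  by apply: abs_summableD => //; exact: abs_summableZ.
apply/abs_summableP; have -> : abs_series 0 = cst 0.
  apply/funext => n; rewrite /abs_series /series /=.
  by apply: big1 => i _; exact: normr0.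
exact: is_cvg_cst.
Qed.

HB.instance Definition _ :=
  GRing.isSubmodClosed.Build R R^nat abs_summable abs_summable_submod_closed.

End Ell1.

Record ell1 (R : realType) := Ell1 {
  ell1_val :> nat -> R;
  ell1_valP : ell1_val \in abs_summable
}.

HB.instance Definition _ (R : realType) := [isSub for @ell1_val R].
HB.instance Definition _ (R : realType) := [Choice of ell1 R by <:].
HB.instance Definition _ (R : realType) :=
  [SubChoice_isSubLmodule of ell1 R by <:].

Section Ell1Norm.
Context {R : realType}.
Implicit Types u v : ell1 R.

Lemma ell1_cvg u : cvgn (abs_series (ell1_val u)).
Proof. exact/abs_summableP/ell1_valP. Qed.

Lemma l1norm_le u n : abs_series (ell1_val u) n <= l1norm u.
Proof.
by apply: nondecreasing_cvgn_le; [exact: abs_series_nd|exact: ell1_cvg].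
Qed.

Lemma l1normD u v : l1norm (u + v) <= l1norm u + l1norm v.
Proof.
apply: limr_le; first exact: ell1_cvg.
apply: nearW => n; apply: le_trans (abs_seriesD_le u v n) _.
by apply: lerD; exact: l1norm_le.
Qed.

Lemma l1normZ (a : R) u : l1norm (a *: u) = `|a| * l1norm u.
Proof.
rewrite /l1norm; have -> : (a *: u : ell1 R) = a *: (u : R^nat) :> R^nat by [].
by rewrite abs_seriesZ; apply: limZr; exact: ell1_cvg.
Qed.

Lemma l1norm_eq0 u : l1norm u = 0 -> u = 0.
Proof.
move=> u0; apply/val_inj/funext => n /=; apply/eqP.
rewrite -normr_le0 -u0; apply: le_trans (l1norm_le u n.+1).
by rewrite /= /abs_series /series /= big_nat_recr//= lerDr sumr_ge0.
Qed.

End Ell1Norm.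

HB.instance Definition _ (R : realType) :=
  Lmodule_isNormed.Build R (ell1 R) (@l1normD R) (@l1normZ R) (@l1norm_eq0 R).

Section Daugavet.
Context {R : realType}.
Implicit Types X E : normedModType R.

(* The usual operator norm when X is not the zero space and T is a bounded
   linear map; otherwise the supremum may take a junk value. *)
Definition opnorm X E (T : X -> E) : R :=
  sup [set `|T x| | x in [set x : X | `|x| <= 1]].

(* The range is a line spanned by a nonzero vector. *)
Definition rank_one X E (T : X -> E) : Prop :=
  exists2 y : E, y != 0 & range T = range (fun a : R => a *: y).

Definition daugavet_property X : Prop :=
  forall T : {linear X -> X}, bounded_fun_norm T -> rank_one T ->
    opnorm (fun x => x + T x) = 1 + opnorm T.

(* Y, with the subspace topology, is linearly homeomorphic to E. The map S' is
   the inverse of S on Y; its values outside Y are irrelevant. *)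
Definition isomorphic_to E X (Y : set X) : Prop :=
  exists (S : {linear E -> X}) (S' : X -> E),
    [/\ range S = Y, cancel S S', continuous S & {within Y, continuous S'}].

Definition contains_copy E X : Prop :=
  exists Y : {pred X},
    [/\ submod_closed Y, closed [set` Y] & isomorphic_to E [set` Y]].

End Daugavet.

(* Main.v *)
From HB Require Import structures.
Require Import Defs.
From mathcomp Require Import all_boot all_order all_algebra.
From mathcomp Require Import all_classical all_reals all_analysis.
From mathcomp Require Import lra.

(** Let X be a nonzero space with the Daugavet property. The goal is a sequence
    x_0, x_1, ... in the unit ball of X such that, for all signs,
      |+-x_0 +- ... +- x_(n-1)| >= n - 1/2.
    Such a sequence is equivalent to the unit vector basis of l1: for real
    coefficients a_i with signs s_i and t = |a_0| + ... + |a_(n-1)|, the sum of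
    the t s_i x_i has norm at least t (n - 1/2) and differs from the sum of the
    a_i x_i by a vector of norm at most the sum of the t - |a_i|, which is
    n t - t; hence the sum of the a_i x_i has norm at least t / 2
    ([l1_lower_estimate]). The operator mapping u in l1 to the sum of the
    u_i x_i is then a contraction bounded below by 1/2, its range is closed
    because l1 is complete, and it is an isomorphism onto its range
    ([copy_of_ell1]).

    To find the next x_n, it is enough to find, for finitely many vectors s
    (the signed sums of the preceding terms), one point x of the unit ball with
    |s + x| >= |s| + 1 - eps for all of them. Slices of the unit ball make this
    possible one vector at a time: every slice A contains a smaller slice all of
    whose points z satisfy |s + z| >= |s| + 1 - eps ([subslice]), so finitely
    many vectors are treated by shrinking the slice again and again.

    For one vector s, write A in terms of a functional f of norm 1 and apply the
    Daugavet property to the rank one operator z |-> f(z) s. It gives a point z1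
    of the ball at which |z1 + f(z1) s| is almost 1 + |s|. A functional h of
    norm 1 that norms z1 + f(z1) s must be almost 1 at z1 and almost |s| at s,
    and f(z1) must be almost 1. Therefore the slice where f + h is almost 2 is
    not empty; on it f is almost 1, so that it lies in A, and h is almost 1, so
    that |s + z| >= h(s) + h(z) is almost |s| + 1. The functional h comes from
    the Hahn-Banach theorem ([hahn_banach]), proved here by showing that a
    minimal sublinear function is linear. *)

Set Implicit Arguments.
Unset Strict Implicit.
Unset Printing Implicit Defensive.

Import Order.TTheory GRing.Theory Num.Theory.
Import numFieldNormedType.Exports.

Local Open Scope classical_set_scope.
Local Open Scope ring_scope.

(** * The Hahn-Banach theorem *)

Section HahnBanach.
Context {R : realType} {V : lmodType R}.
Implicit Types p q : V -> R.

(** Asking only for one inequality in the homogeneity, and only for positive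
    scalars, keeps the verifications below short; equality for all
    nonnegative scalars follows ([sublinearZ]). *)
Definition sublinear q :=
  (forall x y, q (x + y) <= q x + q y) /\
  (forall t x, 0 < t -> q (t *: x) <= t * q x).

Lemma sublinear0 q : sublinear q -> q 0 = 0.
Proof.
case=> _ hom; apply/eqP; rewrite eq_le.
have h2 := hom 2 0 (ltr0n _ 2); have h12 := hom 2^-1 0 _.
rewrite !scaler0 in h2 h12.
by have {}h12 := h12 _; apply/andP; split; lra.
Qed.

Lemma sublinearZ q t x : sublinear q -> 0 <= t -> q (t *: x) = t * q x.
Proof.
move=> subq; rewrite le_eqVlt => /predU1P[<-|t0].
  by rewrite scale0r mul0r sublinear0.
apply/eqP; rewrite eq_le; case: subq => _ hom; rewrite hom//=.
have := hom t^-1 (t *: x); rewrite invr_gt0 scalerA mulVf ?gt_eqF// scale1r.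
by move=> /(_ t0); rewrite ler_pdivlMl.
Qed.

Lemma sublinear_ge q x : sublinear q -> - q (- x) <= q x.
Proof.
move=> subq; rewrite lerNl -subr_ge0 opprK addrC -[leLHS](sublinear0 subq).
by rewrite -(subrr x); exact: subq.1.
Qed.

(** Zorn's lemma applies because the pointwise infimum of a chain of sublinear
    functions below p is sublinear; it is finite since each of them is at least
    x |-> - p (- x). *)
Lemma sublinear_minimal p : sublinear p ->
  exists q, [/\ sublinear q, forall x, q x <= p x &
    forall q', sublinear q' -> (forall x, q' x <= q x) -> q' = q].
Proof.
move=> subp.
pose T := {q : V -> R | sublinear q /\ forall x, q x <= p x}.
pose ge_fun (q q' : T) := `[< forall x, sval q' x <= sval q x >].
have [||||[q [subq qp]] qmin] := @Zorn T ge_fun.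
- by move=> q; apply/asboolP.
- move=> q q' q'' /asboolP qq' /asboolP q'q''; apply/asboolP => x.
  exact: le_trans (q'q'' x) (qq' x).
- move=> [q Pq] [q' Pq'] /asboolP/= qq' /asboolP/= q'q.
  apply: eq_exist; apply/funext => x; apply/eqP.
  by rewrite eq_le qq' q'q.
- move=> A totA; have [[q0 Aq0]|A0] := pselect (A !=set0); last first.
    exists (exist _ p (conj subp (fun=> lexx _))) => q Aq.
    by case: A0; exists q.
  pose E x := [set sval q x | q in A].
  have lbE x : has_lbound (E x).
    exists (- p (- x)) => _ [[q [subq qp]] _ <-] /=.
    by apply: le_trans (sublinear_ge x subq); rewrite lerN2.
  have infE x (q : T) : A q -> inf (E x) <= sval q x.
    by move=> Aq; apply: ge_inf => //; exists q.
  have E0 x : E x !=set0 by exists (sval q0 x); exists q0.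
  have mP : sublinear (fun x => inf (E x)) /\ forall x, inf (E x) <= p x.
    split; [split=> [x y|t x t0]|]; last first.
    + move=> x; apply: le_trans (infE x _ Aq0) _.
      exact: (svalP q0).2.
    + rewrite -ler_pdivrMl//; apply: lb_le_inf => // _ [q Aq <-].
      rewrite ler_pdivrMl//; apply: le_trans (infE _ _ Aq) _.
      exact: (svalP q).1.2.
    + rewrite -lerBlDr; apply: lb_le_inf => // _ [q Aq <-].
      rewrite lerBlDr -lerBlDl; apply: lb_le_inf => // _ [q' Aq' <-].
      rewrite lerBlDl.
      have [/asboolP qq'|/asboolP q'q] := totA _ _ Aq Aq'.
        apply: le_trans (infE _ _ Aq') _.
        by apply: le_trans ((svalP q').1.1 _ _) _; exact: lerD.
      apply: le_trans (infE _ _ Aq) _.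
      by apply: le_trans ((svalP q).1.1 _ _) _; exact: lerD.
  exists (exist _ (fun x => inf (E x)) mP) => q Aq; apply/asboolP => x /=.
  exact: infE.
exists q; split => // q' subq' q'q.
have q'p x : q' x <= p x by exact: le_trans (q'q x) (qp x).
have := qmin (exist _ q' (conj subq' q'p)) (asboolT q'q).
by move=> /(congr1 sval).
Qed.

(** The largest sublinear function below q whose value at - y is at most
    - q y. It shows that a minimal sublinear function is additive, and it
    also forces the functional found by Zorn's lemma to attain the value
    q y at y. *)
Definition sublinear_tilt q y x :=
  inf [set q (x + t *: y) - t * q y | t in [set t | 0 <= t]].

Section Tilt.
Variables (q : V -> R) (y : V).
Hypothesis subq : sublinear q.

Lemma sublinear_tilt_le t x : 0 <= t ->
  sublinear_tilt q y x <= q (x + t *: y) - t * q y.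
Proof.
move=> t0; apply: ge_inf; last by exists t.
exists (- q (- x)) => _ [s /= s0 <-].
rewrite -(sublinearZ y subq s0).
have := subq.1 (x + s *: y) (- x).
by rewrite addrAC subrr add0r; lra.
Qed.

Lemma le_sublinear_tilt a x :
  (forall t, 0 <= t -> a <= q (x + t *: y) - t * q y) ->
  a <= sublinear_tilt q y x.
Proof.
move=> ha; apply: lb_le_inf.
  by exists (q (x + 0 *: y) - 0 * q y), 0 => //=.
by move=> _ [t /= t0 <-]; exact: ha.
Qed.

Lemma sublinear_tiltP : sublinear (sublinear_tilt q y).
Proof.
split=> [x x'|c x c0].
  rewrite -lerBlDr; apply: le_sublinear_tilt => t t0.
  rewrite lerBlDr -lerBlDl; apply: le_sublinear_tilt => s s0.
  rewrite lerBlDl; apply: le_trans (sublinear_tilt_le _ (addr_ge0 t0 s0)) _.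
  have := subq.1 (x + t *: y) (x' + s *: y).
  rewrite addrACA -scalerDl mulrDl; lra.
rewrite -ler_pdivrMl//; apply: le_sublinear_tilt => t t0.
rewrite ler_pdivrMl//.
apply: le_trans (sublinear_tilt_le _ (mulr_ge0 (ltW c0) t0)) _.
by rewrite -scalerA -scalerDr (sublinearZ _ subq (ltW c0)) mulrBr mulrA.
Qed.

Lemma sublinear_tilt_le_self x : sublinear_tilt q y x <= q x.
Proof.
by have := sublinear_tilt_le x (lexx 0); rewrite scale0r mul0r addr0 subr0.
Qed.

End Tilt.

(** Take f minimal below the tilt of p at y. Minimality makes f equal to its own
    tilt at every z, so that f x <= f (x + z) - f z: the function f is additive,
    hence linear. Moreover f (- y) <= - p y, which gives f y = p y. *)
Lemma hahn_banach p y : sublinear p ->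
  exists f : {scalar V}, (forall x, f x <= p x) /\ f y = p y.
Proof.
move=> subp; have subpy := sublinear_tiltP y subp.
have [f [subf fle fmin]] := sublinear_minimal subpy.
have fadd x z : f (x + z) = f x + f z.
  apply/eqP; rewrite eq_le subf.1/=.
  have /(congr1 (fun g => g x))<- := fmin _ (sublinear_tiltP z subf)
    (sublinear_tilt_le_self z subf).
  have := @sublinear_tilt_le f z subf 1 x ler01.
  by rewrite scale1r mul1r lerBrDr.
have fN x : f (- x) = - f x.
  apply/eqP; rewrite -subr_eq0 opprK -fadd addNr.
  by rewrite sublinear0.
have fZ t x : f (t *: x) = t * f x.
  have [t0|t0] := leP 0 t; first exact: sublinearZ.
  rewrite -[t]opprK scaleNr fN (sublinearZ _ subf) ?oppr_ge0 ?ltW//.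
  by rewrite !mulNr.
have flin : scalar f by move=> t x z; rewrite fadd fZ.
pose F := HB.pack_for {scalar V} f (GRing.isLinear.Build _ _ _ _ _ flin).
have fp x : f x <= p x.
  exact: le_trans (fle x) (sublinear_tilt_le_self y subp x).
exists F; split => //; apply/eqP; rewrite eq_le fp/=.
have := le_trans (fle (- y)) (sublinear_tilt_le y subp (- y) ler01).
by rewrite fN scale1r mul1r addNr sublinear0// sub0r lerN2.
Qed.

End HahnBanach.

Lemma norming_functional {R : realType} {X : normedModType R} (y : X) :
  exists f : {scalar X}, (forall x, `|f x| <= `|x|) /\ f y = `|y|.
Proof.
have [|f [fle fy]] := @hahn_banach R X (fun x => `|x|) y.
  by split=> [x z|t x t0]; rewrite ?ler_normD// normrZ gtr0_norm.
exists f; split => // x; rewrite ler_norml fle andbT lerNl.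
by rewrite -linearN -normrN fle.
Qed.

(** * Slices of the unit ball and the Daugavet property *)

(** Here a = f(z1), b = h(z1), c = h(s) and r = |s|. Since a, b <= 1 and c <= r,
    the bound b + a c > 1 + r - eta leaves no room: c, a r and b are within eta
    of r, r and 1. *)
Lemma almost_norming_arith {R : realFieldType} (a b c r eta delta : R) :
    0 < r -> 0 <= a <= 1 -> b <= 1 -> c <= r -> 0 < eta -> delta <= 1 ->
    eta * (1 + r) = delta * r -> 1 + r - eta < b + a * c ->
  r - delta < c /\ 2 - delta < a + b.
Proof.
move=> r0 /andP[a0 a1] b1 cr eta0 delta1 etaE abc.
have eta_r : eta < r by nra.
have eta_delta : eta < delta by nra.
have c0 : 0 < c.
  rewrite ltNge; apply/negP => c_le0.
  by have := mulr_ge0_le0 a0 c_le0; lra.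
have acc : a * c <= c by rewrite ler_piMl// ltW.
have rc : r - eta < c by lra.
split; first by lra.
have acr : a * c <= a * r by rewrite ler_wpM2l.
have ar : a * r <= r by rewrite ler_piMl// ltW.
have b_gt : 1 - eta < b by lra.
have : (1 - eta) * r < b * r by rewrite ltr_pM2r.
by rewrite -(ltr_pM2r r0); nra.
Qed.

Section Slices.
Context {R : realType} {X : normedModType R}.
Implicit Types (A B : set X) (g : {scalar X}).

Definition slice g (alpha : R) : set X := [set z | `|z| <= 1 /\ alpha < g z].

(** Since the slice is not empty, the condition 0 <= alpha makes the functional
    nonzero, so that it can be normalised; the functional itself need not have
    norm 1, which lets a sum of two functionals define a slice. *)
Definition is_slice A := exists g (C alpha : R),
  [/\ forall z, `|g z| <= C * `|z|, 0 <= alpha, A = slice g alpha & A !=set0].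

Lemma exists_slice (x : X) : x != 0 -> exists A, is_slice A.
Proof.
move=> x0; have [f [fle fx]] := norming_functional x.
exists (slice f 0); exists f, 1, 0; split => //.
  by move=> z; rewrite mul1r.
exists (`|x|^-1 *: x); split.
  by rewrite normrZ ger0_norm ?invr_ge0// mulVf ?normr_eq0.
by rewrite linearZ/= fx mulVf ?normr_eq0.
Qed.

Hypothesis daug : daugavet_property X.

Lemma opnorm_le (T : X -> X) (r : R) : (forall x, `|x| <= 1 -> `|T x| <= r) ->
  forall x, `|x| <= 1 -> `|T x| <= opnorm T.
Proof.
move=> Tr x x1; apply: ub_le_sup; last by exists x.
by exists r => _ [z /= z1 <-]; exact: Tr.
Qed.

Lemma opnorm_gt (T : X -> X) (a : R) : a < opnorm T ->
  exists2 x, `|x| <= 1 & a < `|T x|.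
Proof.
move=> aT; have [|_ [x /= x1 <-] ax] := sup_gt _ aT; last by exists x.
by exists `|T 0|, 0 => //=; rewrite normr0.
Qed.

(** The operator z |-> f(z) s has norm |s|, so by the Daugavet property its sum
    with the identity almost attains 1 + |s| on the ball; replacing z by - z
    makes f(z) nonnegative. *)
Lemma daugavet_almost_norming (f : {scalar X}) (s : X) (eta : R) :
    s != 0 -> 0 < eta -> (forall z, `|f z| <= `|z|) ->
    (forall c, (forall z, `|z| <= 1 -> `|f z| <= c) -> 1 <= c) ->
  exists z, [/\ `|z| <= 1, 0 <= f z & 1 + `|s| - eta < `|z + f z *: s|].
Proof.
move=> s0 eta0 fle fsup.
have lin_fs : linear (fun z => f z *: s).
  by move=> t x z; rewrite linearP scalerDl scalerA.
pose T := HB.pack_for {linear X -> X} (fun z => f z *: s)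
  (GRing.isLinear.Build _ _ _ _ _ lin_fs).
have T_le x : `|T x| <= `|x| * `|s| by rewrite normrZ ler_wpM2r.
have T_ball x : `|x| <= 1 -> `|T x| <= `|s|.
  by move=> x1; apply: le_trans (T_le x) _; rewrite ler_piMl.
have T_bnd : bounded_fun_norm T.
  move=> r; exists (r * `|s|) => x xr; apply: le_trans (T_le x) _.
  by rewrite ler_wpM2r.
have [w fw] : exists w, f w != 0.
  apply: contrapT => /forallNP f0; suff: (1 : R) <= 0 by rewrite ler10.
  apply: fsup => z _; have /negP/negPn/eqP-> := f0 z.
  by rewrite normr0.
have T_rank1 : rank_one T.
  exists s => //; apply/seteqP; split => [_ [z _ <-]|_ [a _ <-]].
    by exists (f z).
  by exists ((a / f w) *: w) => //=; rewrite linearZ/= divfK.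
have T_norm : `|s| <= opnorm T.
  rewrite -[leLHS]mul1r -ler_pdivlMr ?normr_gt0//; apply: fsup => z z1.
  rewrite ler_pdivlMr ?normr_gt0// -normrZ.
  exact: (@opnorm_le T `|s|).
have : 1 + `|s| - eta < opnorm (fun x => x + T x).
  by rewrite daug//; lra.
move=> /opnorm_gt[z z1 zT].
have [fz|fz] := leP 0 (f z); first by exists z.
exists (- z); rewrite normrN linearN oppr_ge0 (ltW fz) scaleNr -opprD normrN.
by split.
Qed.

(** The new slice is cut out by f + h, where f is the normalised functional of A
    and h norms the vector z1 + f(z1) s, with z1 the point z given by
    [daugavet_almost_norming]. *)
Lemma subslice1 A (s : X) (eps : R) : is_slice A -> s != 0 -> 0 < eps ->
  exists B, [/\ is_slice B, B `<=` A &
    forall z, B z -> `|s| + 1 - eps <= `|s + z|].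
Proof.
move=> [g [C [alpha [gC alpha0 -> [z0 [z01 gz0]]]]]] s0 eps0.
pose M := sup [set `|g z| | z in [set z | `|z| <= 1]].
have g_le_C z : `|z| <= 1 -> `|g z| <= `|C|.
  move=> z1; apply: le_trans (gC z) _; apply: le_trans (ler_norm _) _.
  by rewrite normrM normr_id ler_piMr.
have gM z : `|z| <= 1 -> `|g z| <= M.
  move=> z1; apply: ub_le_sup; last by exists z.
  by exists `|C| => _ [x /= x1 <-]; exact: g_le_C.
have alphaM : alpha < M.
  apply: lt_le_trans gz0 _; apply: le_trans (ler_norm _) _; exact: gM.
have M0 : 0 < M by exact: le_lt_trans alphaM.
have gM' z : `|g z| <= M * `|z|.
  have [->|z_neq0] := eqVneq z 0; first by rewrite linear0 !normr0 mulr0.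
  have := gM (`|z|^-1 *: z); rewrite linearZ/= normrM normrZ.
  rewrite (ger0_norm (_ : 0 <= `|z|^-1)) ?invr_ge0// mulVf ?normr_eq0//.
  by move=> /(_ (lexx _)); rewrite ler_pdivrMl ?normr_gt0// mulrC.
have flin : scalar (fun z => M^-1 * g z).
  by move=> t x z; rewrite linearP mulrDr mulrCA.
pose f := HB.pack_for {scalar X} (fun z => M^-1 * g z)
  (GRing.isLinear.Build _ _ _ _ _ flin).
have fE z : f z = M^-1 * g z by [].
(* Otherwise simplification unfolds f and hides it from linear arithmetic. *)
clearbody f.
have normf z : `|f z| = M^-1 * `|g z|.
  by rewrite fE normrM gtr0_norm ?invr_gt0.
have fle z : `|f z| <= `|z| by rewrite normf ler_pdivrMl.
have fsup c : (forall z, `|z| <= 1 -> `|f z| <= c) -> 1 <= c.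
  move=> fc; rewrite -(ler_pM2l M0) mulr1; apply: ge_sup.
    by exists `|g 0|, 0 => //=; rewrite normr0.
  move=> _ [z /= z1 <-]; rewrite -ler_pdivrMl//.
  by rewrite -normf; exact: fc.
(* On the new slice |s + z| > |s| + 1 - 2 delta and f > 1 - delta: the two
   bounds make these at least |s| + 1 - eps and alpha / M. *)
pose delta := Num.min (eps / 2) (1 - alpha / M).
have delta0 : 0 < delta.
  by rewrite lt_min divr_gt0//= subr_gt0 ltr_pdivrMr// mul1r.
have delta_eps : delta <= eps / 2 by rewrite ge_min lexx.
have delta_alpha : delta <= 1 - alpha / M by rewrite ge_min lexx orbT.
have delta1 : delta <= 1.
  by apply: le_trans delta_alpha _; rewrite gerBl divr_ge0// ltW.
have ns0 : 0 < `|s| by rewrite normr_gt0.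
(* This is the solution of eta (1 + |s|) = delta |s|. *)
pose eta := delta * (`|s| / (1 + `|s|)).
have q0 : 0 < `|s| / (1 + `|s|) by rewrite divr_gt0// ltr_pwDl.
have eta0 : 0 < eta by exact: mulr_gt0.
have etaE : eta * (1 + `|s|) = delta * `|s|.
  by rewrite /eta -mulrA divfK// gt_eqF// ltr_pwDl.
have [z1 [z1_ball fz1 z1s]] := daugavet_almost_norming s0 eta0 fle fsup.
have [h [hle hz1]] := norming_functional (z1 + f z1 *: s).
have h_le z : h z <= `|z| by exact: le_trans (ler_norm _) (hle z).
have f_le z : f z <= `|z| by exact: le_trans (ler_norm _) (fle z).
have z1s' : 1 + `|s| - eta < h z1 + f z1 * h s.
  have <- : h (z1 + f z1 *: s) = h z1 + f z1 * h s by rewrite linearD linearZ.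
  by rewrite hz1.
have fz1_01 : 0 <= f z1 <= 1 by rewrite fz1 (le_trans (f_le z1)).
have [hs fh] := almost_norming_arith ns0 fz1_01 (le_trans (h_le z1) z1_ball)
  (h_le s) eta0 delta1 etaE z1s'.
exists (slice (f \+ h) (2 - delta)); split.
- exists (f \+ h), 2, (2 - delta); split => //; last by exists z1.
    move=> z /=; apply: le_trans (ler_normD _ _) _.
    by have := hle z; have := fle z; lra.
  lra.
- move=> z [zb fhz]; split => //; have := le_trans (h_le z) zb.
  rewrite /= in fhz; move=> hz.
  have : alpha / M < f z by lra.
  by rewrite ltr_pdivrMr// fE mulrAC mulVf ?mul1r// gt_eqF.
- move=> z [zb /= fhz]; have := h_le (s + z); rewrite linearD/=.
  have := le_trans (f_le z) zb; rewrite /=; lra.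
Qed.

End Slices.

(** * A sequence that behaves like the unit vector basis of l1 *)

Section AlmostL1.
Context {R : realType} {X : normedModType R}.
Hypothesis daug : daugavet_property X.

(** For s = 0 a nonzero point z0 of the slice serves instead of s: from
    |z0 + z| >= |z0| + 1 - eps it follows that |z| >= 1 - eps. *)
Lemma subslice A (s : X) (eps : R) : is_slice A -> 0 < eps ->
  exists B, [/\ is_slice B, B `<=` A &
    forall z, B z -> `|s| + 1 - eps <= `|s + z|].
Proof.
move=> sA eps0; have [->|s0] := eqVneq s 0; last exact: subslice1.
have [g [C [alpha [_ alpha0 defA [z0 Az0]]]]] := sA.
have z0_neq0 : z0 != 0.
  apply: contraTneq alpha0 => z00; move: Az0; rewrite defA z00 => -[_].
  by rewrite linear0 ltNge => /negbTE->.
have [B [sB BA Bz0]] := subslice1 daug sA z0_neq0 eps0.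
exists B; split => // z /Bz0 z0z; rewrite normr0 !add0r.
by have := ler_normD z0 z; lra.
Qed.

Lemma subslice_seq A (L : seq X) (eps : R) : is_slice A -> 0 < eps ->
  exists B, [/\ is_slice B, B `<=` A &
    forall z, B z -> {in L, forall s, `|s| + 1 - eps <= `|s + z|}].
Proof.
move=> sA eps0; elim: L => [|s L [B [sB BA BL]]]; first by exists A; split.
have [B' [sB' B'B B's]] := subslice s sB eps0.
exists B'; split => //; first exact: subset_trans BA.
move=> z B'z t; rewrite inE => /predU1P[->|tL]; first exact: B's.
by apply: BL => //; exact: B'B.
Qed.

Hypothesis X_nonzero : exists x : X, x != 0.

Lemma almost_l1_orthogonal (L : seq X) (eps : R) : 0 < eps ->
  exists x : X, `|x| <= 1 /\ {in L, forall s, `|s| + 1 - eps <= `|s + x|}.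
Proof.
move=> eps0; have [x0 /exists_slice[A sA]] := X_nonzero.
have [B [sB _ BL]] := subslice_seq L sA eps0.
have [g [C [alpha [_ _ defB [z Bz]]]]] := sB.
by exists z; split; [move: Bz; rewrite defB => -[]|exact: BL].
Qed.

(** The recursion carries the list of all signed sums of the terms chosen so
    far. The next term x must move both s and - s away from the origin, for each
    such sum s, because |s - x| = |- s + x|. *)
Lemma almost_l1_sequence : exists x : nat -> X, (forall n, `|x n| <= 1) /\
  forall (b : nat -> bool) n,
    n%:R - 2^-1 <= `|\sum_(0 <= i < n) (-1) ^+ b i *: x i|.
Proof.
have eps0 n : 0 < (2^-1 : R) ^+ n.+2 by rewrite exprn_gt0// invr_gt0.
have pickP n L := cid (almost_l1_orthogonal (L ++ [seq - s | s <- L]) (eps0 n)).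
pose pick n L := sval (pickP n L).
pose sums := fix sums n := if n is m.+1 then
  [seq s + pick m (sums m) | s <- sums m] ++
  [seq s - pick m (sums m) | s <- sums m] else [:: 0].
pose x n := pick n (sums n).
have sumsP (b : nat -> bool) n :
    \sum_(0 <= i < n) (-1) ^+ b i *: x i \in sums n.
  elim: n => [|n IHn]; first by rewrite big_nil /= inE.
  rewrite big_nat_recr//= mem_cat scaler_sign; case: (b n); apply/orP.
    by right; apply: (map_f (fun s => s - x n)).
  by left; apply: (map_f (fun s => s + x n)).
exists x; split=> [n|b n]; first exact: (svalP (pickP n (sums n))).1.
(* The errors 2^-(i+2) for i < n add up to 1/2 - 2^-(n+1). *)
suff: n%:R - 2^-1 + 2^-1 ^+ n.+1 <= `|\sum_(0 <= i < n) (-1) ^+ b i *: x i|.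
  by apply: le_trans; rewrite lerDl exprn_ge0.
elim: n => [|n IHn]; first by rewrite big_nil normr0 expr1 sub0r addNr.
have [_ far] := svalP (pickP n (sums n)).
rewrite big_nat_recr//=; set s := \sum_(0 <= i < n) _ in IHn *.
have ss : s \in sums n by exact: sumsP.
have step : `|s| + 1 - 2^-1 ^+ n.+2 <= `|s + (-1) ^+ b n *: x n|.
  rewrite scaler_sign; case: (b n); last by rewrite far// mem_cat ss.
  rewrite distrC (addrC (x n)) -[`|s|]normrN far//.
  by rewrite mem_cat map_f ?orbT.
apply: le_trans step; rewrite -natr1 (exprS _ n.+1); lra.
Qed.

End AlmostL1.

(** Scaling every coefficient up to the total t = |a_0| + ... + |a_(n-1)| turns
    the sum into t times a signed sum, at a cost of at most n t - t. *)
Lemma l1_lower_estimate {R : realType} {X : normedModType R} (x : nat -> X) :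
    (forall n, `|x n| <= 1) ->
    (forall (b : nat -> bool) n,
      n%:R - 2^-1 <= `|\sum_(0 <= i < n) (-1) ^+ b i *: x i|) ->
  forall (a : nat -> R) n,
    2^-1 * \sum_(0 <= i < n) `|a i| <= `|\sum_(0 <= i < n) a i *: x i|.
Proof.
move=> x1 xb a n; set t := \sum_(0 <= i < n) `|a i|.
have t0 : 0 <= t by exact: sumr_ge0.
pose b i := a i < 0.
have at_le i : (i < n)%N -> `|a i| <= t.
  move=> ltin; rewrite /t big_mkord (bigD1 (Ordinal ltin))//= lerDl.
  exact: sumr_ge0.
have split_sum : t *: \sum_(0 <= i < n) (-1) ^+ b i *: x i =
    \sum_(0 <= i < n) a i *: x i +
    \sum_(0 <= i < n) (t - `|a i|) *: ((-1) ^+ b i *: x i).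
  rewrite scaler_sumr -big_split/=; apply: eq_bigr => i _.
  by rewrite {1}[a i]realEsign ?num_real// scalerBl mulrC -scalerA addrC subrK.
have rest : `|\sum_(0 <= i < n) (t - `|a i|) *: ((-1) ^+ b i *: x i)|
    <= n%:R * t - t.
  apply: le_trans (ler_norm_sum _ _ _) _.
  have -> : n%:R * t - t = \sum_(0 <= i < n) (t - `|a i|).
    by rewrite sumrB sumr_const_nat subn0 mulr_natl.
  rewrite !big_mkord; apply: ler_sum => i _.
  rewrite !normrZ normrX normrN1 expr1n mul1r ger0_norm ?subr_ge0 ?at_le//.
  by rewrite ler_piMr ?subr_ge0 ?at_le.
have := ler_wpM2l t0 (xb b n).
rewrite -{2}(ger0_norm t0) -normrZ split_sum => tn.
have := ler_normD (\sum_(0 <= i < n) a i *: x i)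
  (\sum_(0 <= i < n) (t - `|a i|) *: ((-1) ^+ b i *: x i)).
lra.
Qed.

(** * The operator from l1 and its range *)

Section Ell1Operator.
Context {R : realType} {X : completeNormedModType R} (x : nat -> X).
Hypothesis x_le1 : forall n, `|x n| <= 1.

Definition l1_comb (u : ell1 R) : X := limn (series (fun i => u i *: x i)).

Lemma l1_comb_cvg (u : ell1 R) :
  series (fun i => u i *: x i) @ \oo --> l1_comb u.
Proof.
apply: normed_cvg; apply: (@series_le_cvg _ _ (fun i => `|u i|)).
- by move=> n /=.
- by move=> n /=.
- by move=> n /=; rewrite normrZ ler_piMr.
- exact: ell1_cvg.
Qed.

Lemma l1_comb_linear : linear l1_comb.
Proof.
move=> t u v; apply: cvg_lim => //.
have -> : series (fun i => (t *: u + v) i *: x i) =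
    t *: series (fun i => u i *: x i) + series (fun i => v i *: x i).
  apply/funext => n.
  transitivity (t *: (\sum_(0 <= i < n) u i *: x i) +
    \sum_(0 <= i < n) v i *: x i); last by [].
  rewrite scaler_sumr -big_split; apply: eq_bigr => i _.
  by rewrite scalerA [LHS]scalerDl.
by apply: cvgD; [apply: cvgZr|]; exact: l1_comb_cvg.
Qed.

Lemma l1_comb_norm_cvg (u : ell1 R) :
  (fun n => `|\sum_(0 <= i < n) u i *: x i|) @ \oo --> `|l1_comb u|.
Proof. by apply: cvg_norm; exact: l1_comb_cvg. Qed.

Lemma ell1_norm_cvg (u : ell1 R) :
  (fun n => \sum_(0 <= i < n) `|u i|) @ \oo --> `|u|.
Proof. exact: ell1_cvg. Qed.

Lemma l1_comb_le (u : ell1 R) : `|l1_comb u| <= `|u|.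
Proof.
apply: (ler_cvg_to (@l1_comb_norm_cvg u) (@ell1_norm_cvg u)); apply: nearW => n.
apply: le_trans (ler_norm_sum _ _ _) _.
by apply: ler_sum => i _; rewrite normrZ ler_piMr.
Qed.

Lemma l1_comb_ge (c : R) (u : ell1 R) :
    (forall (a : nat -> R) n,
      c * \sum_(0 <= i < n) `|a i| <= `|\sum_(0 <= i < n) a i *: x i|) ->
  c * `|u| <= `|l1_comb u|.
Proof.
move=> xlow.
have cu : (fun n => c * \sum_(0 <= i < n) `|u i|) @ \oo --> c * `|u|.
  by apply: cvgMr; exact: ell1_norm_cvg.
apply: (ler_cvg_to cu (@l1_comb_norm_cvg u)).
by apply: nearW => n; exact: xlow.
Qed.

End Ell1Operator.

Section Ell1Complete.
Context {R : realType}.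
Implicit Types u v : ell1 R.

Lemma ell1_of_bounded_sums (w : nat -> R) (c : R) :
  (forall n, \sum_(0 <= i < n) `|w i| <= c) ->
  exists2 v : ell1 R, v = w :> (nat -> R) & `|v| <= c.
Proof.
move=> wc.
have w_sum : w \in abs_summable.
  apply/abs_summableP/nondecreasing_is_cvgn; first exact: abs_series_nd.
  by exists c => _ [n _ <-]; exact: wc.
exists (Ell1 w_sum) => //; apply: limr_le; first exact: ell1_cvg.
by apply: nearW => n; exact: wc.
Qed.

Lemma ell1_coord_le u i : `|u i| <= `|u|.
Proof.
apply: le_trans (l1norm_le u i.+1).
by rewrite /abs_series /series /= big_nat_recr//= lerDr sumr_ge0.
Qed.

(** Completeness of l1, with a rate: the limit is taken coordinatewise, and
    letting l tend to infinity in the partial sums of |u_k - u_l| bounds those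
    of |u_k - v| by r_k. *)
Lemma ell1_complete (u : nat -> ell1 R) (r : nat -> R) : r @ \oo --> (0 : R) ->
  (forall k l, `|u k - u l| <= r k + r l) ->
  exists v, forall k, `|u k - v| <= r k.
Proof.
move=> r0 ur.
have coord_cvg i : cvgn (fun k => u k i).
  apply/cauchy_cvgP/cauchy_exP => e e0.
  have e2 : 0 < e / 2 by rewrite divr_gt0.
  have [N _ rN] := (cvgrPdist_lt _ _).1 r0 _ e2.
  exists (u N i); exists N => // k Nk; rewrite /= /ball_ /=.
  apply: le_lt_trans (ell1_coord_le (u N - u k) i) _.
  apply: le_lt_trans (ur N k) _; rewrite [ltRHS](splitr e) ltrD//.
    have := rN N (leqnn N); rewrite /= sub0r normrN.
    by apply: le_lt_trans (ler_norm _).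
  have := rN k Nk; rewrite /= sub0r normrN.
  by apply: le_lt_trans (ler_norm _).
pose w i := limn (fun k => u k i).
have wP k : exists2 v : ell1 R,
    v = (fun i => u k i - w i) :> (nat -> R) & `|v| <= r k.
  apply: ell1_of_bounded_sums => n.
  have lhs : (fun l => \sum_(0 <= i < n) `|u k i - u l i|) @ \oo -->
      \sum_(0 <= i < n) `|u k i - w i|.
    apply: cvg_big => [|i _]; first exact: add_continuous.
    by apply: cvg_norm; apply: cvgB; [exact: cvg_cst|exact: coord_cvg].
  have rhs : (fun l => r k + r l) @ \oo --> r k.
    by rewrite -[X in _ --> X]addr0; apply: cvgD => //; exact: cvg_cst.
  apply: (ler_cvg_to lhs rhs); apply: nearW => l.
  exact: le_trans (l1norm_le (u k - u l) n) (ur k l).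
have [d dE _] := wP 0; exists (u 0 - d) => k; have [d' d'E] := wP k.
suff -> : u k - (u 0 - d) = d' by [].
apply/val_inj/funext => i; change (u k i - (u 0 i - d i) = d' i).
by rewrite dE d'E subKr.
Qed.

End Ell1Complete.

Lemma bounded_below_dist {R : realType} {E X : normedModType R}
    (S : {linear E -> X}) (c : R) : 0 < c ->
    (forall u, c * `|u| <= `|S u|) ->
  forall u v, `|u - v| <= c^-1 * `|S u - S v|.
Proof. by move=> c0 S_ge u v; rewrite ler_pdivlMl// -linearB S_ge. Qed.

Lemma isomorphic_to_range {R : realType} {E X : normedModType R}
    (S : {linear E -> X}) (c : R) : 0 < c ->
    (forall u, `|S u| <= `|u|) -> (forall u, c * `|u| <= `|S u|) ->
  isomorphic_to E (range S).
Proof.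
move=> c0 S_le S_ge; have S_dist := bounded_below_dist c0 S_ge.
pose S' y := xget 0 [set u | S u = y].
have S_inj : injective S.
  move=> u v Suv; apply/eqP; rewrite -subr_eq0 -normr_le0.
  by apply: le_trans (S_dist u v) _; rewrite Suv subrr normr0 mulr0.
have S'K : cancel S S'.
  move=> u; apply: S_inj.
  by apply: (@xgetPex _ 0 [set v | S v = S u]); exists u.
exists S, S'; split => //.
  move=> u; apply/cvgrPdist_lt => e e0; near=> v.
  rewrite -linearB; apply: le_lt_trans (S_le _) _.
  by near: v; exact: cvgr_dist_lt.
apply/subspace_continuousP => _ [u _ <-].
apply/cvgrPdist_lt => e e0; rewrite near_withinE; near=> z => -[v _ zE].
rewrite -zE /from_subspace !S'K; apply: le_lt_trans (S_dist _ _) _; rewrite zE.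
rewrite ltr_pdivrMl//; near: z.
by apply: cvgr_dist_lt; [exact: cvg_id|exact: mulr_gt0].
Unshelve. all: by end_near. Qed.

(** If S u_k tends to y then u_k is a Cauchy sequence, since S is bounded below,
    and S maps its limit to y. *)
Lemma ell1_range_closed {R : realType} {X : normedModType R}
    (S : {linear ell1 R -> X}) (c : R) : 0 < c ->
    (forall u, `|S u| <= `|u|) -> (forall u, c * `|u| <= `|S u|) ->
  closed (range S).
Proof.
move=> c0 S_le S_ge y yY; have S_dist := bounded_below_dist c0 S_ge.
have close k : exists u, `|S u - y| < k.+1%:R^-1.
  have [|_ [[u _ <-]]] := yY (ball y k.+1%:R^-1).
    by apply: nbhsx_ballx; rewrite invr_gt0.
  by rewrite -ball_normE /= distrC; exists u.
have [u uy] := choice close.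
pose r k : R := c^-1 * k.+1%:R^-1.
have r0 : r @ \oo --> (0 : R).
  by rewrite -[X in _ --> X](mulr0 c^-1); apply: cvgMr; exact: cvg_harmonic.
have [k l|v uv] := @ell1_complete _ u r r0.
  apply: le_trans (S_dist _ _) _; rewrite -mulrDr ler_pM2l ?invr_gt0//.
  rewrite -(subrKA y); apply: le_trans (ler_normD _ _) _.
  by rewrite [in X in _ + X]distrC; apply: lerD; exact: ltW.
exists v => //; apply/eqP; rewrite -subr_eq0 -normr_le0.
have lim0 : (fun k => r k + k.+1%:R^-1) @ \oo --> (0 : R).
  by rewrite -[X in _ --> X]addr0; apply: cvgD => //; exact: cvg_harmonic.
apply: (ler_cvg_to (cvg_cst _) lim0); apply: nearW => k.
rewrite -(subrKA (S (u k))); apply: le_trans (ler_normD _ _) _.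
rewrite distrC -linearB; apply: lerD; last exact: ltW.
exact: le_trans (S_le _) (uv k).
Qed.

Lemma copy_of_ell1 {R : realType} {X : normedModType R}
    (S : {linear ell1 R -> X}) (c : R) : 0 < c ->
    (forall u, `|S u| <= `|u|) -> (forall u, c * `|u| <= `|S u|) ->
  contains_copy (ell1 R) X.
Proof.
move=> c0 S_le S_ge.
pose Y : {pred X} := [pred y | `[< exists u, S u = y >]].
have YE : [set` Y] = range S.
  apply/seteqP; split=> [y /asboolP[u <-]|_ [u _ <-]]; first by exists u.
  by apply/asboolP; exists u.
exists Y; rewrite YE; split.
- split=> [|a _ _ /asboolP[u <-] /asboolP[v <-]].
    by apply/asboolP; exists 0; rewrite linear0.
  by apply/asboolP; exists (a *: u + v); rewrite linearP.
- exact: ell1_range_closed S_ge.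
- exact: isomorphic_to_range S_ge.
Qed.

Theorem theorem2p9 (R : realType) (X : completeNormedModType R)
  (X_nonzero : exists x : X, x != 0)
  (X_daugavet : daugavet_property X) :
  contains_copy (ell1 R) X.
Proof.
have [x [x_le1 x_signs]] := almost_l1_sequence X_daugavet X_nonzero.
have x_low := l1_lower_estimate x_le1 x_signs.
pose S := HB.pack_for {linear ell1 R -> X} (l1_comb x)
  (GRing.isLinear.Build _ _ _ _ _ (l1_comb_linear x_le1)).
apply: (@copy_of_ell1 _ _ S 2^-1) => [|u|u]; first by rewrite invr_gt0.
- exact: l1_comb_le.
- exact: l1_comb_ge.
Qed.
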